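(* The map $$\Xi:\mathrm{Diff}_+\mathbf{R}\times\left(C^\infty(J_0^1)\otimes\mathbf{C}\right)\to C^\infty(J_0^1)\otimes\mathbf{C}:(\varphi,\Psi)\mapsto\Xi_\varphi\Psi,$$ where $$\Xi_\varphi\Psi(t,x,\dot x)=(\varphi^{-1})^{1*}[\dot\varphi(t)\Psi(t,x,\dot x)],$$ is a linear representation of $\mathrm{Diff}_+\mathbf{R}$ on $C^\infty(J_0^1)\otimes\mathbf{C}$ preserving the scalar product $$(\Psi_1\mid\Psi_2)=\int_{J_0^1}\overline{\Psi_1(t,x,\dot x)}\,\Psi_2(t,x,\dot x)\,dt\,d^3x\,d^3\dot x.$$
   Context: $J_0^1=\{(t,x,\dot x)\in\mathbf{R}\times\mathbf{R}^3\times\mathbf{R}^3\mid\dot x\neq0\}$, and $C^\infty(J_0^1)\otimes\mathbf{C}$ is the space of complex-valued smooth functions on $J_0^1$. The scalar product is introduced on the compactly supported ones, $C_0^\infty(J_0^1)\otimes\mathbf{C}$. $\mathrm{Diff}_+\mathbf{R}$ is the group of orientation preserving diffeomorphisms of $\mathbf{R}$, and each $\varphi$ in it acts on $J_0^1$ by $\varphi^1(t,x,\dot x)=(\varphi(t),x,\dot x/\dot\varphi(t))$. $(\varphi^{-1})^{1*}$ is pullback by the prolonged action of $\varphi^{-1}$: $((\varphi^{-1})^{1*}\Phi)(t,x,\dot x)=\Phi\big(\varphi^{-1}(t),x,\dot x/(\varphi^{-1})^{\cdot}(t)\big)$, where $(\varphi^{-1})^{\cdot}$ is the derivative of $\varphi^{-1}$.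 Thus $\Xi_\varphi\Psi(t,x,\dot x)=\dot\varphi(\varphi^{-1}(t))\,\Psi\big(\varphi^{-1}(t),x,\dot x/(\varphi^{-1})^{\cdot}(t)\big)$. *)

(* Defs.v *)
From HB Require Import structures.
From mathcomp Require Import all_boot all_order all_algebra.
From mathcomp Require Import all_classical all_reals all_analysis.
From mathcomp Require Import complex.
Set Implicit Arguments.
Unset Strict Implicit.
Unset Printing Implicit Defensive.
Import Order.TTheory GRing.Theory Num.Theory.
Import numFieldNormedType.Exports.
Local Open Scope classical_set_scope.
Local Open Scope complex_scope.
Local Open Scope ring_scope.

(* [Ck k U f] is only meaningful for [U] open: continuity, differentiability
   and derivatives are those of the total function [f] at the points of [U].
   In finite dimension it is the usual C^k, since quantifying over all
   directions [v] amounts to quantifying over the partial derivatives. *)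
Fixpoint Ck (R : realType) (V W : normedModType R) (k : nat) (U : set V)
    (f : V -> W) : Prop :=
  if k is j.+1 then
    (forall x, U x -> differentiable f x) /\ forall v, Ck j U ('D_v f)
  else forall x, U x -> {for x, continuous f}.

Definition smooth_on (R : realType) (V W : normedModType R) (U : set V)
  (f : V -> W) : Prop := forall k, Ck k U f.

Section CkTheory.
Variable R : realType.

Lemma differentiable_near_eq (V W : normedModType R) (f g : V -> W) x :
  (\forall y \near x, f y = g y) -> differentiable f x -> differentiable g x.
Proof.
move=> fg df; have fgx := nbhs_singleton fg.
have [dfc /eqaddoP dfo] : continuous ('d f x) /\
    (f \o shift x = cst (f x) + 'd f x +o_ 0 id) by exact/diff_locallyP.
have dg : g \o shift x = cst (g x) + 'd f x +o_ 0 id.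
  apply/eqaddoP => e e0; have {dfo} := dfo e e0.
  have : \forall h \near (0 : V), f (h + x) = g (h + x).
    by move: fg; rewrite (near_shift 0) subr0.
  apply: filterS2 => h /= fgh; rewrite -fgx.
  by rewrite -[(g \o _ - _) h]/(g (h + x) - _) -fgh.
apply/diff_locallyP; have := diff_unique dfc dg => E; split; last by rewrite E.
by rewrite E.
Qed.

Lemma derive_near_eq (V W : normedModType R) (f g : V -> W) x v :
  (\forall y \near x, f y = g y) -> 'D_v f x = 'D_v g x.
Proof.
move=> fg; have fgx := nbhs_singleton fg; rewrite /derive.
suff E : \forall h \near (0 : R)^', h^-1 *: (f (h *: v + x) - f x) =
    h^-1 *: (g (h *: v + x) - g x).
  congr (lim _); apply/seteqP; split; apply: near_eq_cvg => //.
  by move: E; apply: filterS => h ->.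
have : (fun h : R => h *: v + x) @ 0 --> x.
  rewrite -[X in _ --> X]add0r -[X in _ --> X + _](scale0r v).
  by apply: cvgD; [apply: cvgZr_tmp; exact: cvg_id|exact: cvg_cst].
move=> /(_ _ fg) near0; apply: cvg_within.
have {}near0 : \forall h \near (0 : R), f (h *: v + x) = g (h *: v + x) by [].
by move: near0; apply: filterS => h /= fgh; rewrite fgh fgx.
Qed.

Lemma Ck_eq (V W : normedModType R) k (U : set V) (f g : V -> W) :
  open U -> (forall x, U x -> f x = g x) -> Ck k U f -> Ck k U g.
Proof.
move=> oU; have near_eq (h1 h2 : V -> W) x : (forall y, U y -> h1 y = h2 y) ->
    U x -> \forall y \near x, h1 y = h2 y.
  move=> h12 Ux; have : nbhs x U by exact: open_nbhs_nbhs.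
  exact: filterS.
elim: k f g => [|k IH] f g fg /=.
  move=> fc x Ux; have := fc x Ux; rewrite /prop_for /continuous_at (fg _ Ux).
  apply: cvg_trans; apply: near_eq_cvg.
  by move: (near_eq _ _ _ fg Ux); apply: filterS => y ->.
move=> [fd fD]; split=> [x Ux|v].
  exact: differentiable_near_eq (near_eq _ _ _ fg Ux) (fd x Ux).
apply: IH (fD v) => x Ux; exact: derive_near_eq (near_eq _ _ _ fg Ux).
Qed.

Lemma Ck_cst (V W : normedModType R) k (U : set V) (a : W) :
  Ck k U (cst a : V -> W).
Proof.
elim: k a => [|k IH] a /=; first by move=> x _; exact: cst_continuous.
split=> [x _|v]; first exact: differentiable_cst.
suff -> : 'D_v (cst a : V -> W) = cst 0 by exact: IH.
by apply/funext => x; rewrite derive_cst.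
Qed.

Lemma CkD (V W : normedModType R) k (U : set V) (f g : V -> W) :
  open U -> Ck k U f -> Ck k U g -> Ck k U (f + g).
Proof.
move=> oU; elim: k f g => [|k IH] f g /=.
  by move=> fc gc x Ux; apply: continuousD; [exact: fc|exact: gc].
move=> [fd fD] [gd gD]; split=> [x Ux|v].
  by apply: differentiableD; [exact: fd|exact: gd].
apply: (Ck_eq oU _ (IH _ _ (fD v) (gD v))) => x Ux.
by rewrite deriveD//; apply: diff_derivable; [exact: fd|exact: gd].
Qed.

Lemma CkZ (V W : normedModType R) k (U : set V) (a : R) (f : V -> W) :
  open U -> Ck k U f -> Ck k U (a *: f).
Proof.
move=> oU; elim: k f => [|k IH] f /=.
  by move=> fc x Ux; apply: continuousZl_tmp; exact: fc.
move=> [fd fD]; split=> [x Ux|v]; first by apply: differentiableZ; exact: fd.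
apply: (Ck_eq oU _ (IH _ (fD v))) => x Ux.
by rewrite deriveZ//; apply: diff_derivable; exact: fd.
Qed.

Lemma CkW (V W : normedModType R) k (U : set V) (f : V -> W) :
  Ck k.+1 U f -> Ck k U f.
Proof.
elim: k f => [|k IH] f /= [fd fD].
  by move=> x Ux; apply: differentiable_continuous; exact: fd.
by split=> // v; exact/IH/fD.
Qed.

Lemma CkM (V : normedModType R) k (U : set V) (f g : V -> R) :
  open U -> Ck k U f -> Ck k U g -> Ck k U (f * g).
Proof.
move=> oU; elim: k f g => [|k IH] f g.
  by move=> fc gc x Ux; apply: continuousM; [exact: fc|exact: gc].
move=> fk gk; have [fd fD] := fk; have [gd gD] := gk; split=> [x Ux|v].
  by apply: differentiableM; [exact: fd|exact: gd].
have h : Ck k U (f * 'D_v g + g * 'D_v f).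
  apply: CkD => //; apply: IH; [exact: CkW|exact: gD|exact: CkW|exact: fD].
apply: (Ck_eq oU _ h) => x Ux.
by rewrite deriveM//; apply: diff_derivable; [exact: fd|exact: gd].
Qed.

Lemma Ck_comp1 k (f g : R -> R) :
  Ck k setT f -> Ck k setT g -> Ck k setT (f \o g).
Proof.
elim: k f g => [|k IH] f g.
  by move=> fc gc x _; apply: continuous_comp; [exact: gc|exact: fc].
move=> [fd fD] gk; have [gd gD] := gk; split=> [x _|v].
  by apply: differentiable_comp; [exact: gd|exact: fd].
have h : Ck k setT (('D_1 f \o g) * 'D_v g).
  by apply: (CkM openT); [apply: IH; [exact: fD|exact: CkW]|exact: gD].
apply: (Ck_eq openT _ h) => x _; rewrite !mulrfctE /=.
have dg := gd x I; have df := fd (g x) I.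
rewrite (deriveE (1 : R) df) (deriveE v dg) (deriveE v (differentiable_comp dg df)).
rewrite (diff_comp dg df) /=.
rewrite -[X in _ = 'd f (g x) X]mulr1 [RHS]linearZ; exact: mulrC.
Qed.

Lemma Ck_id k : Ck k setT (idfun : R -> R).
Proof.
case: k => [|k]; first by move=> x _; exact: cvg_id.
split=> [x _|v]; first exact: ex_diff.
suff -> : 'D_v (idfun : R -> R) = cst v by exact: Ck_cst.
by apply/funext => x; rewrite derive_id.
Qed.

End CkTheory.

Section Diffeomorphisms.
Variable R : realType.

(* Orientation preserving diffeomorphisms of the line; the group law below is
   composition. *)
Record diffeo := Diffeo {
  dfun :> R -> R;
  dinv : R -> R;
  dfun_smooth : smooth_on setT dfun;
  dinv_smooth : smooth_on setT dinv;
  dfunK : cancel dfun dinv;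
  dinvK : cancel dinv dfun;
  derive1_dfun_gt0 : forall t, 0 < dfun^`()%classic t }.

Lemma diffeo_eq (f g : diffeo) : dfun f = dfun g -> f = g.
Proof.
case: f g => [f fi sf si fK fiK fp] [g gi sg sgi gK giK gp] /= fg; subst g.
have fgi : fi = gi by apply/funext => t; rewrite -[t in LHS]giK fK.
subst gi.
by congr Diffeo; exact: Prop_irrelevance.
Qed.

HB.instance Definition _ := gen_eqMixin diffeo.
HB.instance Definition _ := gen_choiceMixin diffeo.

Lemma smooth_derivable (f : R -> R) t : smooth_on setT f -> derivable f t 1.
Proof. by move=> /(_ 1%N)[fd _]; apply: diff_derivable; exact: fd. Qed.

Lemma derive1_idfun t : (idfun : R -> R)^`()%classic t = 1.
Proof. by rewrite derive1E derive_id. Qed.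

Lemma derive1_idfun_gt0 t : 0 < (idfun : R -> R)^`()%classic t.
Proof. by rewrite derive1_idfun ltr01. Qed.

Definition diffeo_one : diffeo :=
  @Diffeo idfun idfun (@Ck_id R) (@Ck_id R) (frefl _) (frefl _)
    derive1_idfun_gt0.

Lemma smooth_comp1 (f g : R -> R) :
  smooth_on setT f -> smooth_on setT g -> smooth_on setT (f \o g).
Proof. by move=> sf sg k; exact: Ck_comp1. Qed.

Lemma derive1_mul_gt0 (f g : diffeo) t : 0 < (f \o g)^`()%classic t.
Proof.
rewrite derive1_comp; [|exact/smooth_derivable/dfun_smooth..].
by rewrite mulr_gt0// derive1_dfun_gt0.
Qed.

Definition diffeo_mul (f g : diffeo) : diffeo :=
  @Diffeo (f \o g) (dinv g \o dinv f)
    (smooth_comp1 (@dfun_smooth f) (@dfun_smooth g))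
    (smooth_comp1 (@dinv_smooth g) (@dinv_smooth f))
    (can_comp (@dfunK f) (@dfunK g)) (can_comp (@dinvK g) (@dinvK f))
    (derive1_mul_gt0 f g).

Lemma derive1_dinv_gt0 (f : diffeo) t : 0 < (dinv f)^`()%classic t.
Proof.
have : (f \o dinv f)^`()%classic t = 1.
  have -> : f \o dinv f = idfun by apply/funext => s /=; rewrite dinvK.
  exact: derive1_idfun.
rewrite derive1_comp; first last.
- exact/smooth_derivable/dfun_smooth.
- exact/smooth_derivable/dinv_smooth.
move=> fi1; rewrite -(pmulr_rgt0 _ (derive1_dfun_gt0 f (dinv f t))) fi1.
exact: ltr01.
Qed.

Definition diffeo_inv (f : diffeo) : diffeo :=
  @Diffeo (dinv f) f (@dinv_smooth f) (@dfun_smooth f) (@dinvK f) (@dfunK f)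
    (derive1_dinv_gt0 f).

Lemma diffeo_mulA : associative diffeo_mul.
Proof. by move=> f g h; exact: diffeo_eq. Qed.

Lemma diffeo_mul1g : left_id diffeo_one diffeo_mul.
Proof. by move=> f; exact: diffeo_eq. Qed.

Lemma diffeo_mulg1 : right_id diffeo_one diffeo_mul.
Proof. by move=> f; exact: diffeo_eq. Qed.

Lemma diffeo_mulVg : left_inverse diffeo_one diffeo_inv diffeo_mul.
Proof. by move=> f; apply: diffeo_eq; apply/funext => t; exact: dfunK. Qed.

Lemma diffeo_mulgV : right_inverse diffeo_one diffeo_inv diffeo_mul.
Proof. by move=> f; apply: diffeo_eq; apply/funext => t; exact: dinvK. Qed.

HB.instance Definition _ := isGroup.Build diffeo
  diffeo_mulA diffeo_mul1g diffeo_mulg1 diffeo_mulVg diffeo_mulgV.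

End Diffeomorphisms.

Section SmoothFunctions.
Variable R : realType.

(* Points are ((t, x), v), with v the velocity. *)
Definition J01 : set (R * (R * R * R) * (R * R * R)) := [set p | p.2 != 0].

(* ['valL_ 0] extends by 0 outside [J01]; as [J01] is open, smoothness on it
   does not depend on the extension. *)
Definition smoothJ_pred (Psi : J01 -> R[i]) : Prop :=
  smooth_on J01 ((@complex.Re R) \o 'valL_ 0 Psi) /\
  smooth_on J01 ((@complex.Im R) \o 'valL_ 0 Psi).

Definition smoothJ_mem : {pred J01 -> R[i]} := fun Psi => `[< smoothJ_pred Psi >].

Record smoothJ := SmoothJ {
  smoothJ_fun :> J01 -> R[i];
  _ : smoothJ_fun \in smoothJ_mem }.

Lemma J01_open : open J01.
Proof.
have -> : J01 = snd @^-1` [set v : R * R * R | v != 0] by [].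
apply: open_comp; first by move=> p _; exact: cvg_snd.
rewrite (_ : [set v | v != 0] = ~` [set 0]).
  apply/closed_openC/accessible_closed_set1/hausdorff_accessible.
  exact: norm_hausdorff.
by apply/seteqP; split=> v /= /eqP.
Qed.

Lemma valL0E (W : Type) (g : R[i] -> W) (Psi : J01 -> R[i]) p :
  g ('valL_ 0 Psi p) = if insub p is Some q then g (Psi q) else g 0.
Proof. by rewrite /= oinv_set_val; case: insubP. Qed.

Lemma smooth_onD (f g : R * (R * R * R) * (R * R * R) -> R) :
  smooth_on J01 f -> smooth_on J01 g -> smooth_on J01 (f + g).
Proof. by move=> sf sg k; apply: (CkD J01_open). Qed.

Lemma smooth_onZ a (f : R * (R * R * R) * (R * R * R) -> R) :
  smooth_on J01 f -> smooth_on J01 (a *: f).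
Proof. by move=> sf k; apply: (CkZ _ J01_open). Qed.

Lemma smoothJ_subsemimod : subsemimod_closed smoothJ_mem.
Proof.
split; first split.
- apply/asboolP; split=> k.
    rewrite (_ : _ \o _ = cst 0); first exact: Ck_cst.
    by apply/funext => p; rewrite [LHS]valL0E; case: insub.
  rewrite (_ : _ \o _ = cst 0); first exact: Ck_cst.
  by apply/funext => p; rewrite [LHS]valL0E; case: insub.
- move=> Psi Phi /asboolP[rPsi iPsi] /asboolP[rPhi iPhi].
  apply/asboolP; split.
    rewrite (_ : _ \o _ = (@complex.Re R \o 'valL_ 0 Psi) +
        (@complex.Re R \o 'valL_ 0 Phi)); first exact: smooth_onD.
    apply/funext => p; rewrite [LHS]valL0E
      [RHS](congr2 +%R (valL0E _ _ _) (valL0E _ _ _)).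
    case: insub => [q|] /=; last by rewrite addr0.
    by rewrite -[(Psi + Phi) q]/(Psi q + Phi q); case: (Psi q) (Phi q) => ? ? [].
  rewrite (_ : _ \o _ = (@complex.Im R \o 'valL_ 0 Psi) +
      (@complex.Im R \o 'valL_ 0 Phi)); first exact: smooth_onD.
  apply/funext => p; rewrite [LHS]valL0E
      [RHS](congr2 +%R (valL0E _ _ _) (valL0E _ _ _)).
  case: insub => [q|] /=; last by rewrite addr0.
  by rewrite -[(Psi + Phi) q]/(Psi q + Phi q); case: (Psi q) (Phi q) => ? ? [].
- move=> [a b] Psi /asboolP[rPsi iPsi].
  apply/asboolP; split.
    rewrite (_ : _ \o _ = (a *: (@complex.Re R \o 'valL_ 0 Psi)) +
        (- b) *: (@complex.Im R \o 'valL_ 0 Psi)).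
      by apply: smooth_onD; exact: smooth_onZ.
    apply/funext => p; rewrite [LHS]valL0E.
    rewrite [RHS](congr2 (fun x y => a * x + - b * y)
      (valL0E _ _ _) (valL0E _ _ _)).
    case: insub => [q|] /=; last by rewrite !mulr0 addr0.
    rewrite -[(_ *: Psi) q]/((a +i* b) * Psi q).
    by case: (Psi q) => c d /=; rewrite mulNr.
  rewrite (_ : _ \o _ = (a *: (@complex.Im R \o 'valL_ 0 Psi)) +
      b *: (@complex.Re R \o 'valL_ 0 Psi)).
    by apply: smooth_onD; exact: smooth_onZ.
  apply/funext => p; rewrite [LHS]valL0E.
  rewrite [RHS](congr2 (fun x y => a * x + b * y)
    (valL0E _ _ _) (valL0E _ _ _)).
  case: insub => [q|] /=; last by rewrite !mulr0 addr0.
  rewrite -[(_ *: Psi) q]/((a +i* b) * Psi q).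
  by case: (Psi q) => c d.
Qed.

HB.instance Definition _ := [isSub for smoothJ_fun].
HB.instance Definition _ := [Choice of smoothJ by <:].
HB.instance Definition _ :=
  GRing.isSubmodClosed.Build R[i] (J01 -> R[i]) smoothJ_mem smoothJ_subsemimod.
HB.instance Definition _ := 
  GRing.SubChoice_isSubLmodule.Build R[i] (J01 -> R[i]) smoothJ_mem smoothJ
    smoothJ_subsemimod.

End SmoothFunctions.

Arguments J01 R : clear implicits.

Section Action.
Variable R : realType.

Lemma prolong_subproof (phi : diffeo R) (p : J01 R) :
  (phi (val p).1.1, (val p).1.2,
    ((dfun phi)^`()%classic (val p).1.1)^-1 *: (val p).2) \in J01 R.
Proof.
apply/mem_set; rewrite /J01 /= scaler_eq0 invr_eq0.
rewrite gt_eqF ?derive1_dfun_gt0//=.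
exact: (set_mem (valP p)).
Qed.

Definition prolong (phi : diffeo R) (p : J01 R) : J01 R :=
  SigSub (prolong_subproof phi p).

Definition pullback (phi : diffeo R) (Phi : J01 R -> R[i]) : J01 R -> R[i] :=
  Phi \o prolong phi.

Definition Xi (phi : diffeo R) (Psi : J01 R -> R[i]) : J01 R -> R[i] :=
  pullback phi^-1%g
    (fun p => ((dfun phi)^`()%classic (val p).1.1)%:C * Psi p).

Lemma XiE (phi : diffeo R) (Psi : J01 R -> R[i]) (p : J01 R) :
  Xi phi Psi p =
  ((dfun phi)^`()%classic (dinv phi (val p).1.1))%:C * Psi (prolong phi^-1%g p).
Proof. by []. Qed.

End Action.

Definition compactly_supported (R : realType) (Psi : J01 R -> R[i]) : Prop :=
  exists K : set (R * (R * R * R) * (R * R * R)),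
    [/\ compact K, K `<=` J01 R & forall p : J01 R, ~ K (val p) -> Psi p = 0].

(* The library's own instance of this fact is not inferred for general
   sigma-finite measures. *)
Lemma product_measure1_sigma_finite (d1 d2 : measure_display)
    (T1 : measurableType d1) (T2 : measurableType d2) (R : realType)
    (m1 : {sigma_finite_measure set T1 -> \bar R})
    (m2 : {sigma_finite_measure set T2 -> \bar R}) :
  sigma_finite setT (m1 \x m2)%E.
Proof.
have /sigma_finiteP[F [TF ndF Foo]] := sigma_finiteT m1.
have /sigma_finiteP[G [TG ndG Goo]] := sigma_finiteT m2.
exists (fun n => F n `*` G n).
  rewrite -setXTT TF TG predeqE => -[x y]; split.
    move=> [/= [n _ Fnx] [k _ Gky]]; exists (maxn n k) => //; split.
    - by move: x Fnx; exact/subsetPset/ndF/leq_maxl.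
    - by move: y Gky; exact/subsetPset/ndG/leq_maxr.
  by move=> [n _ []/= ? ?]; split; exists n.
move=> k; have [? ?] := Foo k; have [? ?] := Goo k.
split; first exact: measurableX.
by rewrite product_measure1E// lte_mul_pinfty// ge0_fin_numE.
Qed.

Section ScalarProduct.
Variable R : realType.
Local Notation leb := (@lebesgue_measure R).

Definition lebesgue_R2 := (leb \x leb)%E.
HB.instance Definition _ := Measure.on lebesgue_R2.
HB.instance Definition _ := Measure_isSigmaFinite.Build _ _ _ lebesgue_R2
  (product_measure1_sigma_finite leb leb).

Definition lebesgue_R3 := (lebesgue_R2 \x leb)%E.
HB.instance Definition _ := Measure.on lebesgue_R3.
HB.instance Definition _ := Measure_isSigmaFinite.Build _ _ _ lebesgue_R3
  (product_measure1_sigma_finite lebesgue_R2 leb).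

Definition lebesgue_RR3 := (leb \x lebesgue_R3)%E.
HB.instance Definition _ := Measure.on lebesgue_RR3.
HB.instance Definition _ := Measure_isSigmaFinite.Build _ _ _ lebesgue_RR3
  (product_measure1_sigma_finite leb lebesgue_R3).

Definition lebesgue_RR3R3 := (lebesgue_RR3 \x lebesgue_R3)%E.
HB.instance Definition _ := Measure.on lebesgue_RR3R3.
HB.instance Definition _ := Measure_isSigmaFinite.Build _ _ _ lebesgue_RR3R3
  (product_measure1_sigma_finite lebesgue_RR3 lebesgue_R3).

Definition scalar_product (Psi1 Psi2 : J01 R -> R[i]) : R[i] :=
  let F : R * (R * R * R) * (R * R * R) -> R[i] :=
    'valL_ 0 (fun p : J01 R => (Psi1 p)^* * Psi2 p) in
  (\int[lebesgue_RR3R3]_(p in J01 R) complex.Re (F p)) +i*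
  (\int[lebesgue_RR3R3]_(p in J01 R) complex.Im (F p)).

End ScalarProduct.

Definition linear_representation (G : groupType) (K : fieldType)
    (V : lmodType K) (rho : G -> V -> V) : Prop :=
  [/\ forall g, linear (rho g),
      forall v, rho 1%g v = v &
      forall g h v, rho (g * h)%g v = rho g (rho h v)].

(* Main.v *)
Require Import Defs.
From HB Require Import structures.
From mathcomp Require Import all_boot all_order all_algebra.
From mathcomp Require Import all_classical all_reals all_analysis.
From mathcomp Require Import complex measurable_realfun.
Set Implicit Arguments.
Unset Strict Implicit.
Unset Printing Implicit Defensive.
Import Order.TTheory GRing.Theory Num.Theory.
Import numFieldNormedType.Exports.
Local Open Scope ring_scope.

(** Write [psi] for the inverse of [phi] and [c t = phi'(psi t)], so that
    [psi' t = (c t)^-1] and [Xi phi Psi] is [c t * Psi (G (t, x, v))] with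
    [G (t, x, v) = (psi t, x, c t *: v)].  Everything is read off this formula.

    The group law is the chain rule for [phi \o chi].  Smoothness of
    [Xi phi Psi] is the chain rule in several variables: [G] is a combination
    of seven fixed vectors with smooth scalar coefficients, and for such inner
    maps the directional derivatives of the composite are again sums of
    products of the same shape ([Ck_comp_lincomb]).  The support of
    [Xi phi Psi] lies in the image of the support of [Psi] under the
    prolongation of [phi], which is continuous.

    For the scalar product, the integrand [conj Psi1 * Psi2] is multiplied by
    [c t ^ 2] and composed with [G].  The Jacobian of [G] is
    [psi' t * c t ^ 3 = c t ^ 2]: the scaling of the three velocities
    contributes [c t ^ 3] and the change of time [(c t)^-1].  The weight [c]
    in [Xi] is thus exactly a square root of the Jacobian, and the integral is
    unchanged.

    This change of variables is done one real variable at a time, by Tonelli's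
    theorem applied to the positive and negative parts of the integrand.  The
    inner integrals are only known to be measurable functions of the remaining
    variables, so the one-dimensional formula is needed for arbitrary
    nonnegative measurable functions ([ge0_change_of_variables]).  It says that
    the image under [F] of the measure with density [F'] is the Lebesgue
    measure, which by uniqueness of the latter has to be checked on intervals,
    where it is the fundamental theorem of calculus.  Finally, the integrands
    are continuous functions on an open subset of a seven-dimensional space, and
    are measurable for the product of the seven Borel sigma-algebras because
    that space has a countable base of boxes. *)

(** * Smooth functions of several variables *)

Section ContinuousMaps.
Local Open Scope classical_set_scope.

Lemma continuous_compose (A B C : topologicalType) (g : A -> B) (f : B -> C) :
  continuous f -> continuous g -> continuous (f \o g).
Proof.
by move=> cf cg p; apply: continuous_comp; [exact: cg|exact: cf].
Qed.

Lemma continuous_pair (T A B : topologicalType) (f : T -> A) (g : T -> B) :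
  continuous f -> continuous g -> continuous (fun x => (f x, g x)).
Proof. by move=> cf cg x; exact: cvg_pair (cf x) (cg x). Qed.

Lemma continuous_fstT (A B : topologicalType) : continuous (@fst A B).
Proof. by move=> p; exact: cvg_fst. Qed.

Lemma continuous_sndT (A B : topologicalType) : continuous (@snd A B).
Proof. by move=> p; exact: cvg_snd. Qed.

End ContinuousMaps.

Section Smoothness.
Local Open Scope classical_set_scope.
Variable R : realType.

(** The inner map is given by scalar coefficients on fixed vectors because the
    derivative of [f] at [G x] in the moving direction ['D_w G x] then expands
    into the functions ['D_(b i) f \o G], to which the induction applies. *)
Lemma Ck_comp_lincomb (V W : normedModType R) (U : set V) (U' : set W) n
    (b : 'I_n -> V) (g : 'I_n -> W -> R) (f : V -> R) k :
  open U' -> (forall x, U' x -> U (\sum_(i < n) g i x *: b i)) ->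
  (forall i, Ck k U' (g i)) -> Ck k U f ->
  Ck k U' (fun x => f (\sum_(i < n) g i x *: b i)).
Proof.
move=> oU' GU; pose G x := \sum_(i < n) g i x *: b i.
rewrite -[X in Ck k U' X]/(f \o G).
have GE : G = \sum_(i < n) (fun x => g i x *: b i).
  by apply/funext => x; rewrite fct_sumE.
elim: k f => [|k IH] f gk fk.
  move=> x U'x; apply: (@continuous_comp _ _ _ G f); last exact: fk (GU _ U'x).
  suff G0 : Ck 0 U' G by exact: G0.
  rewrite GE; apply: (big_ind (fun h => Ck 0 U' h)) => [|h1 h2|i _].
  - exact: Ck_cst.
  - exact: CkD.
  - by move=> y U'y; apply: cvgZr_tmp; exact: gk.
have [fd fD] := fk.
have dGi i x : U' x -> differentiable (fun x => g i x *: b i) x.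
  by move=> U'x; apply: differentiableZl; have [gd _] := gk i; exact: gd.
have dG x : U' x -> differentiable G x.
  by move=> U'x; rewrite GE; apply: differentiable_sum => i; exact: dGi.
split=> [x U'x|w].
  by apply: (@differentiable_comp _ _ _ _ G f); [exact: dG|exact/fd/GU].
have h : Ck k U' (\sum_(i < n) ('D_w (g i) * ('D_(b i) f \o G))).
  apply: (big_ind (fun h => Ck k U' h)) => [|h1 h2|i _]; first exact: Ck_cst.
    exact: CkD.
  apply: CkM => //; first by have [_ gD] := gk i; exact: gD.
  by apply: IH => [j|]; [exact: CkW (gk j)|exact: fD].
apply: (Ck_eq oU' _ h) => x U'x.
have dGx := dG x U'x; have dfx : differentiable f (G x) := fd _ (GU _ U'x).
have DG : 'D_w G x = \sum_(i < n) 'D_w (g i) x *: b i.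
  rewrite GE derive_sum => [|i]; last by apply: diff_derivable; exact: dGi.
  apply: eq_bigr => i _; have [gd _] := gk i; have dgx := gd x U'x.
  by rewrite (deriveE w (dGi i x U'x)) (deriveE w dgx) diffZl.
rewrite (deriveE w (differentiable_comp dGx dfx)) (diff_comp dGx dfx) /=.
rewrite -(deriveE w dGx) DG linear_sum fct_sumE; apply: eq_bigr => i _.
by rewrite [RHS]linearZ /= -(deriveE (b i) dfx).
Qed.

Lemma Ck_linear (V W : normedModType R) k (U : set V) (f : {linear V -> W}) :
  continuous f -> Ck k U f.
Proof.
move=> cf; case: k => [|k] /=; first by move=> x _; exact: cf.
split=> [x _|v]; first exact: linear_differentiable.
rewrite (_ : 'D_v f = cst (f v)); first exact: Ck_cst.
apply/funext => x; rewrite deriveE; last exact: linear_differentiable.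
by rewrite diff_lin.
Qed.

Lemma Ck_comp_scalar (W : normedModType R) k (U : set W) (f : R -> R)
    (g : W -> R) :
  open U -> Ck k setT f -> Ck k U g -> Ck k U (f \o g).
Proof.
move=> oU fk gk.
have := @Ck_comp_lincomb R W setT U 1 (fun=> 1) (fun=> g) f k oU.
move=> /(_ (fun _ _ => I) (fun=> gk) fk).
apply: Ck_eq => // x _; congr f.
by rewrite big_ord1; exact: mulr1.
Qed.

Lemma smooth_derive1 (f : R -> R) :
  smooth_on setT f -> smooth_on setT (f^`()%classic : R -> R).
Proof.
move=> sf k; have [_ /(_ 1)] := sf k.+1.
by apply: Ck_eq; [exact: openT|move=> x _; rewrite derive1E].
Qed.

End Smoothness.

(** * The prolonged action and smoothness of its pullbacks *)

Section Prolongation.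
Local Open Scope classical_set_scope.
Variable R : realType.
Local Notation V := (R * (R * R * R) * (R * R * R))%type.
Local Notation dinv := Defs.dinv.

(** [prolong] on the whole ambient space, zero velocities included, so that it
    can be handled as a map between normed modules. *)
Definition prolong_ext (phi : diffeo R) (p : V) : V :=
  (phi p.1.1, p.1.2, ((dfun phi)^`()%classic p.1.1)^-1 *: p.2).

Lemma derive1_dinv (phi : diffeo R) t :
  (dinv phi)^`()%classic t = ((dfun phi)^`()%classic (dinv phi t))^-1.
Proof.
have : (phi \o dinv phi)^`()%classic t = 1.
  rewrite (_ : phi \o dinv phi = idfun) ?derive1_idfun//.
  by apply/funext => s /=; rewrite dinvK.
rewrite derive1_comp; [|exact/smooth_derivable/dinv_smooth
                       |exact/smooth_derivable/dfun_smooth].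
move=> e; apply: (mulfI (lt0r_neq0 (derive1_dfun_gt0 phi (dinv phi t)))).
by rewrite e divff// lt0r_neq0 // derive1_dfun_gt0.
Qed.

Lemma prolong_ext_J01 (phi : diffeo R) p : J01 R (prolong_ext phi p) <-> J01 R p.
Proof.
rewrite /J01 /= scaler_eq0 invr_eq0.
by rewrite gt_eqF ?derive1_dfun_gt0.
Qed.

Let std_basis : seq V := [:: (1, 0, 0);
  (0, (1, 0, 0), 0); (0, (0, 1, 0), 0); (0, (0, 0, 1), 0);
  (0, 0, (1, 0, 0)); (0, 0, (0, 1, 0)); (0, 0, (0, 0, 1))].

Lemma std_basis_lincomb (t a : R) (x v : R * R * R) :
  (t, x, a *: v) = \sum_(i < 7)
  [:: t; x.1.1; x.1.2; x.2; a * v.1.1; a * v.1.2; a * v.2]`_i *: std_basis`_i.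
Proof.
rewrite !big_ord_recl big_ord0 /=.
case: x v => [[x1 x2] x3] [[v1 v2] v3] /=.
have s1 (y : R) : y%:A = y :> R by exact: mulr1.
by congr (_, (_, _, _), (_, _, _)); rewrite /= !(s1, scaler0, addr0, add0r).
Qed.

Definition coordinate (i : 'I_7) (p : V) : R :=
  [:: p.1.1; p.1.2.1.1; p.1.2.1.2; p.1.2.2; p.2.1.1; p.2.1.2; p.2.2]`_i.

Lemma Ck_coordinate k (U : set V) i : Ck k U (coordinate i).
Proof.
have FF (A B C : normedModType R) : continuous (fst \o fst : A * B * C -> A).
  exact: continuous_compose (@continuous_fstT _ _) (@continuous_fstT _ _).
have SF (A B C : normedModType R) : continuous (snd \o fst : A * B * C -> B).
  exact: continuous_compose (@continuous_sndT _ _) (@continuous_fstT _ _).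
have lin (f : {linear V -> R}) : continuous f -> Ck k U f by exact: Ck_linear.
pose S (A B : normedModType R) := @continuous_sndT A B.
case: i => -[|[|[|[|[|[|[|//]]]]]]] ? /=.
- exact: (lin (fst \o fst) (@FF _ _ _)).
- exact: (lin (fst \o fst \o (snd \o fst)) (continuous_compose (@FF _ _ _) (@SF _ _ _))).
- exact: (lin (snd \o fst \o (snd \o fst)) (continuous_compose (@SF _ _ _) (@SF _ _ _))).
- exact: (lin (snd \o (snd \o fst)) (continuous_compose (@S _ _) (@SF _ _ _))).
- exact: (lin (fst \o fst \o snd) (continuous_compose (@FF _ _ _) (@S _ _))).
- exact: (lin (snd \o fst \o snd) (continuous_compose (@SF _ _ _) (@S _ _))).
- exact: (lin (snd \o snd) (continuous_compose (@S _ _) (@S _ _))).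
Qed.

Lemma smooth_dinv_derive (phi : diffeo R) :
  smooth_on setT (fun t => ((dfun phi)^`()%classic t)^-1).
Proof.
have := smooth_comp1 (smooth_derive1 (@dinv_smooth _ phi)) (@dfun_smooth _ phi).
move=> s k; apply: Ck_eq (s k); first exact: openT.
by move=> t _; rewrite /= derive1_dinv dfunK.
Qed.

Lemma smooth_prolong (phi : diffeo R) (f : V -> R) :
  smooth_on (J01 R) f -> smooth_on (J01 R) (f \o prolong_ext phi).
Proof.
move=> sf k; pose c t := ((dfun phi)^`()%classic t)^-1.
pose w i p := [:: (phi \o coordinate (@Ordinal 7 0 isT)) p;
  p.1.2.1.1; p.1.2.1.2; p.1.2.2;
  c p.1.1 * p.2.1.1; c p.1.1 * p.2.1.2; c p.1.1 * p.2.2]`_i.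
have GE p : prolong_ext phi p = \sum_(i < 7) w i p *: std_basis`_i.
  exact: std_basis_lincomb.
have -> : f \o prolong_ext phi = fun p => f (\sum_(i < 7) w i p *: std_basis`_i).
  by apply/funext => p; rewrite -GE.
apply: (@Ck_comp_lincomb _ _ _ (J01 R)); [exact: J01_open| | |exact: sf].
  by move=> p pJ; rewrite -GE; exact/prolong_ext_J01.
have Jo := @J01_open R.
have cc : Ck k (J01 R) (c \o coordinate (@Ordinal 7 0 isT)).
  by apply: Ck_comp_scalar; [|exact: smooth_dinv_derive|exact: Ck_coordinate].
have cr j : Ck k (J01 R) (coordinate j) by exact: Ck_coordinate.
case=> -[|[|[|[|[|[|[|//]]]]]]] ? /=.
- by apply: Ck_comp_scalar => //; exact: dfun_smooth.
- exact: (cr (@Ordinal 7 1 isT)).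
- exact: (cr (@Ordinal 7 2 isT)).
- exact: (cr (@Ordinal 7 3 isT)).
- exact: (CkM Jo cc (cr (@Ordinal 7 4 isT))).
- exact: (CkM Jo cc (cr (@Ordinal 7 5 isT))).
- exact: (CkM Jo cc (cr (@Ordinal 7 6 isT))).
Qed.

End Prolongation.

(** * The representation *)

Section Representation.
Local Open Scope classical_set_scope.
Variable R : realType.
Local Notation V := (R * (R * R * R) * (R * R * R))%type.
Local Notation dinv := Defs.dinv.

Lemma J01_val p : J01 R p -> exists q : J01 R, p = val q.
Proof. by move=> Jp; exists (SigSub (mem_set Jp)). Qed.

Lemma valL0_val (Psi : J01 R -> R[i]) (q : J01 R) : 'valL_ 0 Psi (val q) = Psi q.
Proof. by rewrite (valL0E id) valK. Qed.

Lemma valL0_out (Psi : J01 R -> R[i]) p : ~ J01 R p -> 'valL_ 0 Psi p = 0.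
Proof. by move=> pJ; rewrite (valL0E id) insubN //; apply/negP => /set_mem. Qed.

(** No case distinction is left in this formula: [prolong_ext] preserves the
    complement of [J01], where both sides vanish. *)
Lemma valL_Xi (phi : diffeo R) (Psi : J01 R -> R[i]) p :
  'valL_ 0 (Xi phi Psi) p =
  (((dfun phi)^`()%classic (dinv phi p.1.1))%:C)%C *
     'valL_ 0 Psi (prolong_ext phi^-1%g p).
Proof.
have [pJ|pJ] := pselect (J01 R p); last first.
  by rewrite !valL0_out ?mulr0 // prolong_ext_J01.
have [q ->] := J01_val pJ.
by rewrite valL0_val XiE -valL0_val.
Qed.

Lemma smoothJ_Xi (phi : diffeo R) (Psi : J01 R -> R[i]) :
  Psi \in @smoothJ_mem R -> Xi phi Psi \in @smoothJ_mem R.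
Proof.
move=> /asboolP[sre sim]; apply/asboolP.
have Jo := @J01_open R.
have sc : smooth_on (J01 R)
    (fun p : V => (dfun phi)^`()%classic (dinv phi p.1.1)).
  move=> k; apply: (Ck_comp_scalar (f := (dfun phi)^`()%classic \o dinv phi)
    (g := coordinate (@Ordinal 7 0 isT))) => //; last exact: Ck_coordinate.
  by apply: (smooth_comp1 (smooth_derive1 (@dfun_smooth _ phi))); exact: dinv_smooth.
split=> k.
  apply: (Ck_eq Jo _ (CkM Jo (sc k) (smooth_prolong phi^-1%g sre k))) => p _.
  rewrite -[RHS]/(complex.Re ('valL_ 0 (Xi phi Psi) p)) valL_Xi.
  rewrite -[LHS]/((dfun phi)^`()%classic (dinv phi p.1.1) *
    complex.Re ('valL_ 0 Psi (prolong_ext phi^-1%g p))).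
  by case: ('valL_ 0 Psi _) => a b /=; rewrite mul0r subr0.
apply: (Ck_eq Jo _ (CkM Jo (sc k) (smooth_prolong phi^-1%g sim k))) => p _.
rewrite -[RHS]/(complex.Im ('valL_ 0 (Xi phi Psi) p)) valL_Xi.
rewrite -[LHS]/((dfun phi)^`()%classic (dinv phi p.1.1) *
  complex.Im ('valL_ 0 Psi (prolong_ext phi^-1%g p))).
by case: ('valL_ 0 Psi _) => a b /=; rewrite mul0r addr0.
Qed.

Definition XiJ (phi : diffeo R) (Psi : smoothJ R) : smoothJ R :=
  SmoothJ (smoothJ_Xi phi (valP Psi)).

Lemma XiJ_representation : linear_representation XiJ.
Proof.
split.
- move=> phi a f g; apply: val_inj; apply/funext => p.
  rewrite -[LHS]/(Xi phi (a *: smoothJ_fun f + smoothJ_fun g) p).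
  rewrite -[RHS]/(a * Xi phi f p + Xi phi g p) !XiE.
  by rewrite -[(_ + _) _]/(a * f _ + g _) mulrDr mulrCA.
- move=> f; apply: val_inj; apply/funext => p /=; rewrite XiE derive1_idfun mul1r.
  congr (f _); apply: val_inj => /=; rewrite derive1_idfun invr1 scale1r.
  by case: (val p) => -[].
- move=> phi chi f; apply: val_inj; apply/funext => p /=; rewrite !XiE /= mulrA.
  congr (_ * f _).
    rewrite derive1_comp; [|exact/smooth_derivable/dfun_smooth..].
    by rewrite dinvK rmorphM.
  apply: val_inj => /=; congr (_, _, _).
  rewrite scalerA derive1_comp; [|exact/smooth_derivable/dinv_smooth..].
  by rewrite invfM.
Qed.

Lemma continuous_prolong_ext (phi : diffeo R) : continuous (prolong_ext phi).
Proof.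
have c1 : continuous phi by move=> t; exact: (dfun_smooth phi 0).
have c2 : continuous (fun t => ((dfun phi)^`()%classic t)^-1).
  by move=> t; exact: (smooth_dinv_derive phi 0).
have c11 : continuous (fun p : V => p.1.1).
  exact: continuous_compose (@continuous_fstT _ _) (@continuous_fstT _ _).
have cx : continuous (fun p : V => p.1.2).
  exact: continuous_compose (@continuous_sndT _ _) (@continuous_fstT _ _).
apply: (@continuous_pair _ _ _ (fun p => (phi p.1.1, p.1.2))).
  exact: continuous_pair (continuous_compose c1 c11) cx.
move=> p; apply: cvgZ; last exact: cvg_snd.
exact: continuous_compose c2 c11 p.
Qed.

Lemma compactly_supported_Xi (phi : diffeo R) (Psi : J01 R -> R[i]) :
  compactly_supported Psi -> compactly_supported (Xi phi Psi).
Proof.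
move=> [K [cK KJ K0]]; exists (prolong_ext phi @` K); split.
- apply: continuous_compact cK; apply: continuous_subspaceT.
  exact: continuous_prolong_ext.
- by move=> _ [p Kp <-]; apply/prolong_ext_J01/KJ.
- move=> p pK; rewrite XiE K0 ?mulr0 // => Kp; apply: pK.
  exists (val (prolong phi^-1%g p)) => //.
  rewrite /prolong_ext /= dinvK derive1_dinv invrK scalerA mulVf ?scale1r.
    by case: (sval p) => -[].
  by rewrite lt0r_neq0 // derive1_dfun_gt0.
Qed.

End Representation.

(** * Change of variables on the line *)

Section ChangeOfVariables.
Local Open Scope classical_set_scope.
Local Open Scope ereal_scope.

Lemma ge0_integral_mrestr d (T : measurableType d) (R : realType)
    (mu : {measure set T -> \bar R}) (D : set T) (mD : measurable D)
    (f : T -> \bar R) :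
  measurable_fun setT f -> (forall x, 0 <= f x) ->
  \int[mrestr mu mD]_x f x = \int[mu]_(x in D) f x.
Proof.
move=> mf f0.
rewrite (@ge0_negligible_integral _ _ _ (mrestr mu mD) setT (~` D)) //; last 2 first.
- exact: measurableC.
- by rewrite /= /mrestr setICl measure0.
rewrite setTD setCK.
by apply: eq_measure_integral => A mA AD; rewrite /= /mrestr setIidl.
Qed.

(** Restricting [mu \x lebesgue_measure] to the region under the graph of [g]
    and pushing it forward by [F \o fst] yields a measure by construction, and
    Tonelli's theorem identifies it with the image under [F] of the measure of
    density [g] with respect to [mu]. *)
Lemma exists_pushforward_density d d' (T : measurableType d)
    (Y : measurableType d') (R : realType)
    (mu : {sigma_finite_measure set T -> \bar R}) (F : T -> Y) (g : T -> R) :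
  measurable_fun setT F -> measurable_fun setT g -> (forall x, (0 <= g x)%R) ->
  exists m : {measure set Y -> \bar R},
    forall f : Y -> \bar R, measurable_fun setT f -> (forall y, 0 <= f y) ->
    \int[m]_y f y = \int[mu]_x (f (F x) * (g x)%:E).
Proof.
move=> mF mg g0; pose leb := @lebesgue_measure R.
pose D : set (T * R) := [set z | (0 < z.2)%R && (z.2 <= g z.1)%R].
have mD : measurable D.
  have mb : measurable_fun setT (fun z : T * R => (0 < z.2)%R && (z.2 <= g z.1)%R).
    apply: measurable_and.
      by apply: measurable_realfun.measurable_fun_ltr => //; exact: measurable_snd.
    apply: measurable_realfun.measurable_fun_ler; first exact: measurable_snd.
    exact: measurableT_comp mg measurable_fst.
  by rewrite -[D]setTI; exact: mb.
have mFf : measurable_fun setT (F \o fst : T * R -> Y).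
  exact: measurableT_comp mF measurable_fst.
exists (pushforward (mrestr (mu \x leb) mD) (F \o fst)) => f mf f0.
rewrite ge0_integral_pushforward //.
have mfF : measurable_fun setT (f \o (F \o fst) : T * R -> \bar R).
  exact: measurableT_comp mf mFf.
rewrite preimage_setT ge0_integral_mrestr //; last by move=> z; exact: f0.
rewrite integral_mkcond fubini_tonelli1; last 2 first.
- by apply/(measurable_restrictT _ _).1 => //; exact: measurable_funTS.
- by move=> z; apply: erestrict_ge0 => w _; exact: f0.
apply: eq_integral => x _; rewrite /fubini_F.
rewrite (_ : (fun y => _) = (cst (f (F x)) \_ `]0%R, g x]) :> (R -> _)); last first.
  by apply/funext => y; rewrite !patchE; congr (if _ then _ else _).
transitivity (\int[lebesgue_measure]_(y in `]0%R, g x]) (cst (f (F x)) : R -> _) y).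
  by rewrite [RHS]integral_mkcond.
rewrite integral_cst //; congr (_ * _).
rewrite [LHS](lebesgue_measure_itv `]0%R, g x]%R) /=.
rewrite lte_fin sube0; case: ltP => // gx0.
by rewrite (@le_anti _ _ (g x) 0%R) ?gx0 ?g0.
(* Pushforwards are measures only along measurable maps. *)
Unshelve. exact: mFf.
Qed.

(** The image under [F] of the measure with density [F'] gives to the interval
    from [a] to [b] the integral of [F'] from [G a] to [G b], which is [b - a];
    it is therefore the Lebesgue measure. *)
Lemma ge0_change_of_variables (R : realType) (F G : R -> R) (f : R -> \bar R) :
  cancel F G -> cancel G F -> (forall x, derivable F x 1) ->
  continuous (F^`()%classic : R -> R) -> (forall x, (0 < F^`()%classic x)%R) ->
  measurable_fun setT f -> (forall y, 0 <= f y) ->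
  \int[lebesgue_measure]_y f y =
  \int[lebesgue_measure]_x (f (F x) * (F^`()%classic x)%:E).
Proof.
move=> FK GK dF cF' F'0 mf f0.
have cF : continuous F.
  by move=> x; apply: differentiable_continuous; exact/derivable1_diffP.
have mF' := continuous_measurable_fun cF'.
have [m mE] := @exists_pushforward_density _ _ _ (measurableTypeR R) _
  (@lebesgue_measure R) _ _ (continuous_measurable_fun cF) mF' (fun x => ltW (F'0 x)).
rewrite -mE //; apply: eq_measure_integral => A mA _.
apply: lebesgue_measure_unique => //= _ [[a b] _ <-] /=.
have [ab|ba] := ltP a b; last by rewrite set_itv_ge ?measure0 // bnd_simp -leNgt.
have Flt x y : (x < y)%R -> (F x < F y)%R.
  move=> xy; apply: (@gtr0_derive1_lt_cc _ F x y) => //.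
  - exact: continuous_subspaceT.
  - by rewrite bound_itvE ltW.
  - by rewrite bound_itvE ltW.
have Fle : {mono F : x y / (x <= y)%R} by apply: le_mono.
have Fincr : {mono F : x y / (x < y)%R} by exact: leW_mono.
have GaGb : (G a < G b)%R by rewrite -Fincr !GK.
pose S : set R := `]a, b]%classic; pose S' : set R := `]G a, G b]%classic.
have mS : measurable (S : set (measurableTypeR R)) by exact: measurable_itv.
have E : (fun x => (\1_S (F x))%:E * (F^`()%classic x)%:E) =
    (fun x => (F^`()%classic x)%:E) \_ S'.
  apply/funext => x; rewrite patchE indicE.
  have -> : (F x \in S) = (x \in S').
    by rewrite !mem_setE !in_itv /= -{1}(GK a) -{1}(GK b) Fle Fincr.
  by case: ifPn => _; rewrite ?mul1e ?mul0e.
have -> : m S = \int[lebesgue_measure]_(x in `[G a, G b]) (F^`()%classic x)%:E.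
  transitivity (\int[m]_x (\1_S x)%:E); first by rewrite integral_indic ?setIT.
  rewrite mE; last 2 first.
  - by apply/measurable_EFinP; exact: measurable_indic.
  - by move=> y; rewrite lee_fin.
  rewrite E -integral_mkcond integral_itv_obnd_cbnd //.
  exact/measurable_EFinP/measurable_funTS.
rewrite (continuous_FTC2 (F := F) GaGb) ?GK; last 3 first.
- exact: continuous_subspaceT.
- split; first by move=> x _; exact: dF.
  + by apply: cvg_at_right_filter; exact: cF.
  + by apply: cvg_at_left_filter; exact: cF.
- by move=> x _.
by rewrite lebesgue_measure_itv /= lte_fin ab.
Qed.

Lemma ge0_integral_scale (R : realType) (a : R) (f : R -> \bar R) :
  (0 < a)%R -> measurable_fun setT f -> (forall x, 0 <= f x) ->
  \int[lebesgue_measure]_x f (a * x)%R =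
  (a^-1)%:E * \int[lebesgue_measure]_x f x.
Proof.
move=> a0 mf f0; pose F (x : R) : R := (a * x)%R.
have a1 : a != 0%R by rewrite gt_eqF.
have dF (x : R) : is_derive x (1%R : R) F a.
  by rewrite -[X in is_derive _ _ _ X]mulr1; exact: (@is_deriveZ _ _ _ id).
have F'E : F^`()%classic = cst a.
  by apply/funext => x; rewrite derive1E derive_val.
rewrite [in RHS](@ge0_change_of_variables R F (fun x => a^-1 * x)%R) //.
- rewrite F'E /= ge0_integralZr //; last by rewrite lee_fin ltW.
    by rewrite [RHS]muleCA -EFinM mulVf // mule1.
  by apply: measurableT_comp mf _; exact: measurable_funM.
- by move=> x; rewrite /F mulKf.
- by move=> x; rewrite /F mulVKf.
- by rewrite F'E; move=> x; exact: cvg_cst.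
- by move=> x; rewrite F'E.
Qed.

End ChangeOfVariables.

(** * Change of variables in the seven-dimensional space *)

Section ScaledMeasures.
Local Open Scope classical_set_scope.
Local Open Scope ereal_scope.

(** The image of [m] under [p] is [c] times [m], expressed on integrals since
    this is the form in which Tonelli's theorem produces and consumes it. *)
Definition scales d (T : measurableType d) (R : realType)
    (m : {measure set T -> \bar R}) (p : T -> T) (c : R) : Prop :=
  forall f : T -> \bar R, measurable_fun setT f -> (forall x, 0 <= f x) ->
  \int[m]_x f (p x) = c%:E * \int[m]_x f x.

Lemma scales_prod d1 d2 (T1 : measurableType d1) (T2 : measurableType d2)
    (R : realType) (m1 : {sigma_finite_measure set T1 -> \bar R})
    (m2 : {sigma_finite_measure set T2 -> \bar R})
    (p1 : T1 -> T1) (p2 : T2 -> T2) (c1 c2 : R) :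
  measurable_fun setT p1 -> measurable_fun setT p2 ->
  (0 <= c1)%R -> (0 <= c2)%R ->
  scales m1 p1 c1 -> scales m2 p2 c2 ->
  scales (m1 \x m2) (fun z => (p1 z.1, p2 z.2)) (c1 * c2)%R.
Proof.
move=> mp1 mp2 c10 c20 s1 s2 f mf f0.
have mfx x : measurable_fun setT (fun y => f (x, y)).
  exact: measurableT_comp mf (pair1_measurable x).
have mF := measurable_fun_fubini_tonelli_F (m2 := m2) f mf f0.
have F0 x : 0 <= fubini_F m2 f x by apply: integral_ge0 => y _; exact: f0.
rewrite (fubini_tonelli1 (m1 := m1) (m2 := m2) (fun z => f (p1 z.1, p2 z.2))) //; last first.
  apply: (measurableT_comp mf); apply: measurable_fun_pair.
    exact: measurableT_comp mp1 measurable_fst.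
  exact: measurableT_comp mp2 measurable_snd.
rewrite /fubini_F /=; under eq_integral => x _ do rewrite (s2 (fun y => f (p1 x, y))) //.
rewrite ge0_integralZl //; last 2 first.
- exact: measurableT_comp mF mp1.
- by move=> x _; exact: F0.
rewrite (s1 (fubini_F m2 f)) // muleA -EFinM [(c2 * c1)%R]mulrC.
by rewrite -fubini_tonelli1.
Qed.

Lemma scales_R3 (R : realType) (a : R) : (0 < a)%R ->
  scales (@lebesgue_R3 R) (fun v => a *: v) (a ^- 3)%R.
Proof.
move=> a0; pose L := measurableTypeR R.
have am0 : measurable_fun setT (fun x : R => a * x)%R by exact: measurable_funM.
have am : measurable_fun setT ((fun x : R => a * x)%R : L -> L) := am0.
have s1 : scales (@lebesgue_measure R) (fun x : R => a * x)%R a^-1%R.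
  by move=> f mf f0; exact: ge0_integral_scale.
have ai0 : (0 <= a^-1)%R by rewrite invr_ge0 ltW.
have s2 : scales (@lebesgue_R2 R) (fun x : L * L => (a * x.1, a * x.2)%R)
    (a^-1 * a^-1)%R := scales_prod am am ai0 ai0 s1 s1.
have m2 : measurable_fun setT ((fun x => (a * x.1, a * x.2)%R) : (L * L -> L * L)%type).
  apply: measurable_fun_pair.
    exact: measurableT_comp am measurable_fst.
  exact: measurableT_comp am measurable_snd.
have aa0 := mulr_ge0 ai0 ai0.
have s3 := @scales_prod _ _ (L * L)%type L R (@lebesgue_R2 R)
  (@lebesgue_measure R) _ _ _ _ m2 am aa0 ai0 s2 s1.
move=> f mf f0; have := s3 f mf f0.
rewrite -expr2 -exprSr exprVn => <-.
by apply: eq_integral => -[[x y] z] _.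
Qed.

(** The fibres over [(t, x)] are transformed by [S t], the base by [G] in time.
    The velocities are integrated first, at fixed time, which turns the
    weight [k t] into [k t * w t]; the remaining change of time then has
    Jacobian [F'], and [k (F s) * w (F s) * F' s = 1]. *)
Lemma ge0_integral_skew (R : realType) (L := measurableTypeR R)
    (X := (L * L * L)%type) (m3 := @lebesgue_R3 R)
    (F G k w : R -> R) (S : R -> X -> X) (f : L * X * X -> \bar R) :
  cancel F G -> cancel G F -> (forall x, derivable F x 1) ->
  continuous (F^`()%classic : R -> R) -> (forall x, (0 < F^`()%classic x)%R) ->
  measurable_fun setT (G : L -> L) ->
  measurable_fun setT (k : L -> R) ->
  measurable_fun setT (w : L -> R) ->
  measurable_fun setT (fun z : L * X => S z.1 z.2) ->
  (forall t, (0 <= k t)%R) -> (forall t, (0 <= w t)%R) ->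
  (forall t, scales m3 (S t) (w t)) ->
  (forall s, (k (F s) * w (F s) * F^`()%classic s = 1)%R) ->
  measurable_fun setT f -> (forall p, 0 <= f p) ->
  \int[@lebesgue_RR3R3 R]_p
     ((k p.1.1)%:E * f (G p.1.1, p.1.2, S p.1.1 p.2)) =
  \int[@lebesgue_RR3R3 R]_p f p.
Proof.
move=> FK GK dF cF' F'0 mG mk mw mS k0 w0 Sw kwF mf f0.
pose H := fubini_F m3 f.
have mH : measurable_fun setT H by exact: measurable_fun_fubini_tonelli_F.
have H0 q : 0 <= H q by apply: integral_ge0 => y _; exact: f0.
have m11 : measurable_fun setT (fun p : L * X * X => p.1.1).
  exact: measurableT_comp measurable_fst measurable_fst.
pose g (p : L * X * X) : \bar R := (k p.1.1)%:E * f (G p.1.1, p.1.2, S p.1.1 p.2).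
have mG11 : measurable_fun setT (fun p : L * X * X => (G p.1.1 : L)).
  exact: measurableT_comp mG m11.
have m12 : measurable_fun setT (fun p : L * X * X => p.1.2).
  exact: measurableT_comp measurable_snd measurable_fst.
have mS2 : measurable_fun setT (fun p : L * X * X => S p.1.1 p.2).
  exact: measurableT_comp mS (measurable_fun_pair m11 measurable_snd).
have mk11 : measurable_fun setT (fun p : L * X * X => k p.1.1).
  exact: measurableT_comp mk m11.
have mg : measurable_fun setT g.
  apply: emeasurable_funM; first exact/measurable_EFinP.
  apply: (measurableT_comp mf).
  exact: measurable_fun_pair (measurable_fun_pair mG11 m12) mS2.
have g0 p : 0 <= g p.
  by apply: mule_ge0; [rewrite lee_fin; exact: k0|exact: f0].
have gE : fubini_F m3 g = fun q => ((k q.1 * w q.1)%:E * H (G q.1, q.2)).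
  apply/funext => q; rewrite /fubini_F /g /=.
  have mfq : measurable_fun setT (fun y => f (G q.1, q.2, y)).
    exact: measurableT_comp mf (pair1_measurable _).
  have mSq : measurable_fun setT (S q.1) := measurableT_comp mS (pair1_measurable q.1).
  rewrite ge0_integralZl ?lee_fin //; last first.
    exact: measurableT_comp mfq mSq.
  by rewrite (Sw q.1 (fun y => f (G q.1, q.2, y))) // muleA -EFinM.
have mH' : measurable_fun setT (fubini_F m3 g) by exact: measurable_fun_fubini_tonelli_F.
have H'0 q : 0 <= fubini_F m3 g q by apply: integral_ge0 => y _; exact: g0.
transitivity (\int[@lebesgue_RR3 R]_q fubini_F m3 g q).
  exact: (@fubini_tonelli1 _ _ _ _ _ (@lebesgue_RR3 R) m3 g mg g0).
transitivity (\int[@lebesgue_RR3 R]_q H q); last first.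
  exact/esym/(@fubini_tonelli1 _ _ _ _ _ (@lebesgue_RR3 R) m3 f mf f0).
transitivity (\int[m3]_x fubini_G (@lebesgue_measure R) (fubini_F m3 g) x).
  exact: (@fubini_tonelli2 _ _ _ _ _ (@lebesgue_measure R) m3 _ mH' H'0).
transitivity (\int[m3]_x fubini_G (@lebesgue_measure R) H x); last first.
  exact/esym/(@fubini_tonelli2 _ _ _ _ _ (@lebesgue_measure R) m3 _ mH H0).
apply: eq_integral => x _; rewrite /fubini_G gE /=.
rewrite (ge0_change_of_variables FK GK dF cF' F'0).
- by apply: eq_integral => s _; rewrite FK muleAC -EFinM kwF mul1e.
- by move: mH'; rewrite gE => mH'2; exact: measurableT_comp mH'2 (pair2_measurable x).
- by move=> t; apply: mule_ge0; [rewrite lee_fin; exact: mulr_ge0|exact: H0].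
Qed.

End ScaledMeasures.

Section ProlongedIntegral.
Local Open Scope classical_set_scope.
Variable R : realType.
Local Notation dinv := Defs.dinv.
Local Notation L := (measurableTypeR R).
Local Notation VL := (L * (L * L * L) * (L * L * L))%type.

Lemma ge0_integral_prolong (phi : diffeo R) (f : VL -> \bar R) :
  measurable_fun setT f -> (forall p, 0 <= f p)%E ->
  (\int[@lebesgue_RR3R3 R]_p
    ((((dfun phi)^`()%classic (dinv phi p.1.1) ^+ 2)%:E * f (prolong_ext phi^-1%g p))) =
  \int[@lebesgue_RR3R3 R]_p f p)%E.
Proof.
move=> mf f0; pose c t := (dfun phi)^`()%classic (dinv phi t).
have c0 t : 0 < c t by exact: derive1_dfun_gt0.
have cphi' : continuous ((dfun phi)^`()%classic : R -> R).
  by move=> t; exact: (smooth_derive1 (@dfun_smooth _ phi) 0).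
have cdinv : continuous (dinv phi) by move=> t; exact: (@dinv_smooth _ phi 0).
have cc : continuous c.
  by move=> t; apply: continuous_comp; [exact: cdinv|exact: cphi'].
have mc : measurable_fun setT (c : R -> R) := continuous_measurable_fun cc.
have mcL : measurable_fun setT (c : L -> R) := mc.
have mS : measurable_fun setT (fun z : L * (L * L * L) =>
    (c z.1 *: (z.2 : R * R * R) : (L * L * L)%type)).
  have m1 : measurable_fun setT (fun z : L * (L * L * L) => c z.1).
    exact: measurableT_comp mcL measurable_fst.
  have m2 : measurable_fun setT (fun z : L * (L * L * L) => z.2.2 : R).
    exact: measurableT_comp measurable_snd measurable_snd.
  have m21 : measurable_fun setT (fun z : L * (L * L * L) => z.2.1).
    exact: measurableT_comp measurable_fst measurable_snd.
  have m211 : measurable_fun setT (fun z : L * (L * L * L) => z.2.1.1 : R).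
    exact: measurableT_comp measurable_fst m21.
  have m212 : measurable_fun setT (fun z : L * (L * L * L) => z.2.1.2 : R).
    exact: measurableT_comp measurable_snd m21.
  have h1 := measurable_funM m1 m211.
  have h2 := measurable_funM m1 m212.
  have h3 := measurable_funM m1 m2.
  exact: (measurable_fun_pair (measurable_fun_pair h1 h2) h3).
(* What the weight and the scaling of the velocities leave is the inverse of the
   density [phi'] that the change of time brings in. *)
have Ec t : c t ^+ 2 * c t ^- 3 = (c t)^-1.
  by rewrite [in c t ^- 3]exprS invfM mulrCA mulfV ?mulr1 // expf_neq0 // gt_eqF.
have dphi x : derivable phi x 1 by exact/smooth_derivable/dfun_smooth.
have mdinv : measurable_fun setT (dinv phi : R -> R) := continuous_measurable_fun cdinv.
have mk : measurable_fun setT (fun t : R => c t ^+ 2) by exact: measurable_funX.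
have mw : measurable_fun setT (fun t : R => c t ^- 3).
  rewrite (_ : (fun t => _) = (fun t => (dinv phi)^`()%classic t ^+ 3)).
    apply: measurable_funX; apply: continuous_measurable_fun => t.
    exact: (smooth_derive1 (@dinv_smooth _ phi) 0).
  by apply/funext => t; rewrite derive1_dinv exprVn.
have := @ge0_integral_skew R phi (dinv phi) (fun t => c t ^+ 2) (fun t => c t ^- 3)
  (fun t v => (c t *: (v : R * R * R))) f (@dfunK _ phi) (@dinvK _ phi) dphi cphi'
  (@derive1_dfun_gt0 _ phi) mdinv mk mw mS.
move=> <- //.
- apply: eq_integral => p _; rewrite /prolong_ext /=.
  by rewrite derive1_dinv invrK.
- by move=> t; exact/ltW/exprn_gt0.
- by move=> t; rewrite invr_ge0; exact/ltW/exprn_gt0.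
- by move=> t; exact: scales_R3.
- by move=> s; rewrite Ec /c dfunK mulVf // gt_eqF // derive1_dfun_gt0.
Qed.

Lemma Rintegral_prolong (phi : diffeo R) (f : VL -> R) :
  measurable_fun setT f ->
  \int[@lebesgue_RR3R3 R]_p
    ((dfun phi)^`()%classic (dinv phi p.1.1) ^+ 2 * f (prolong_ext phi^-1%g p)) =
  \int[@lebesgue_RR3R3 R]_p f p.
Proof.
move=> mf; congr fine; rewrite integralE [RHS]integralE.
have mp : measurable_fun setT (fun p => (Num.max (f p) 0)%:E).
  by apply/measurable_EFinP; exact: measurable_maxr.
have mn : measurable_fun setT (fun p => (Num.max (- f p) 0)%:E).
  apply/measurable_EFinP; apply: measurable_maxr => //.
  exact: measurableT_comp mf.
have p0 p : (0 <= (Num.max (f p) 0)%:E)%E by rewrite lee_fin le_max lexx orbT.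
have n0 p : (0 <= (Num.max (- f p) 0)%:E)%E by rewrite lee_fin le_max lexx orbT.
have k0 t : 0 <= (dfun phi)^`()%classic (dinv phi t) ^+ 2.
  by rewrite exprn_ge0 // ltW // derive1_dfun_gt0.
congr (_ - _)%E.
  transitivity (\int[@lebesgue_RR3R3 R]_p (Num.max (f p) 0)%:E)%E; last first.
    by apply: eq_integral => p _; rewrite funeposE -EFin_max.
  rewrite -(ge0_integral_prolong phi mp p0); apply: eq_integral => p _.
  by rewrite funeposE -EFin_max -EFinM maxr_pMr ?mulr0.
transitivity (\int[@lebesgue_RR3R3 R]_p (Num.max (- f p) 0)%:E)%E; last first.
  by apply: eq_integral => p _; rewrite funenegE -EFinN -EFin_max.
rewrite -(ge0_integral_prolong phi mn n0); apply: eq_integral => p _.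
by rewrite funenegE -EFinN -EFin_max -EFinM maxr_pMr ?mulr0 ?mulrN.
Qed.

End ProlongedIntegral.

(** * Measurability of the integrands *)

Section Measurability.
Local Open Scope classical_set_scope.

(** The sigma-algebra is a bare family of sets because the topology and the
    measurable structure of a product of copies of [R] live on different,
    merely convertible, types. *)
Definition measurable_base (T : topologicalType) (M : set (set T)) : Prop :=
  exists (I : countType) (B : I -> set T), (forall i, M (B i)) /\
    forall x U, nbhs x U -> exists2 i, B i x & B i `<=` U.

Lemma open_measurable_base (T : topologicalType) (M : set (set T)) (U : set T) :
  sigma_algebra setT M -> measurable_base M -> open U -> M U.
Proof.
move=> [M0 _ MU] [I [B [MB BU]]] oU.
pose F n := if unpickle n is Some i then
  (if `[< B i `<=` U >] then B i else set0) else set0.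
have -> : U = \bigcup_n F n.
  apply/seteqP; split=> [x Ux|x [n _]].
    have [i Bix iU] := BU x U (open_nbhs_nbhs (conj oU Ux)).
    by exists (pickle i) => //; rewrite /F pickleK asboolT.
  rewrite /F; case: unpickle => // i; case: ifPn => // /asboolP iU; exact: iU.
apply: MU => n; rewrite /F; case: unpickle => // i; case: ifPn => // _; exact: MB.
Qed.

Lemma measurable_base_prod (T1 T2 : topologicalType) (M1 : set (set T1))
    (M2 : set (set T2)) (M : set (set (T1 * T2))) :
  (forall A B, M1 A -> M2 B -> M (A `*` B)) ->
  measurable_base M1 -> measurable_base M2 -> measurable_base M.
Proof.
move=> MX [I1 [B1 [MB1 B1U]]] [I2 [B2 [MB2 B2U]]].
exists (I1 * I2)%type, (fun i => B1 i.1 `*` B2 i.2); split.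
  by move=> i; exact: MX.
move=> [x y] U [[U1 U2] /= [xU1 yU2] U12].
have [i B1x B1i] := B1U x U1 xU1; have [j B2y B2j] := B2U y U2 yU2.
exists (i, j) => // -[z w] [/= zi wj]; apply: U12; split; [exact: B1i|exact: B2j].
Qed.

Lemma measurable_base_R (R : realType) :
  measurable_base (@measurable _ (measurableTypeR R) : set (set R)).
Proof.
exists (rat * rat)%type, (fun z => `](ratr z.1 : R), ratr z.2[%classic); split.
  by move=> z; exact: measurable_itv.
move=> x U /nbhs_ballP[e /= e0 xU].
have [p pP] : exists q : rat, ratr q \in `]x - e, x[%R.
  by apply: rat_in_itvoo; rewrite ltrBlDr ltrDl.
have [q qP] : exists q : rat, ratr q \in `]x, x + e[%R.
  by apply: rat_in_itvoo; rewrite ltrDl.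
move: pP qP; rewrite !in_itv /= => /andP[p1 p2] /andP[q1 q2].
exists (p, q) => /=; first by rewrite in_itv /= p2 q1.
move=> y /=; rewrite in_itv /= => /andP[py yq]; apply: xU.
rewrite /ball /= ltr_distlC (lt_trans p1 py) /=.
exact: lt_trans yq q2.
Qed.

Lemma open_measurable_R7 (R : realType) (L := measurableTypeR R)
  (U : set (R * (R * R * R) * (R * R * R))) : open U ->
  measurable (U : set (L * (L * L * L) * (L * L * L))%type).
Proof.
apply: open_measurable_base; first exact: sigma_algebra_measurable.
have b1 := measurable_base_R R.
have b2 : @measurable_base (R * R)%type (@measurable _ (L * L)%type).
  by apply: (measurable_base_prod _ b1 b1) => A B; exact: measurableX.
have b3 : @measurable_base (R * R * R)%type (@measurable _ (L * L * L)%type).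
  by apply: (measurable_base_prod _ b2 b1) => A B; exact: measurableX.
have b4 : @measurable_base (R * (R * R * R))%type (@measurable _ (L * (L * L * L))%type).
  by apply: (measurable_base_prod _ b1 b3) => A B; exact: measurableX.
by apply: (measurable_base_prod _ b4 b3) => A B; exact: measurableX.
Qed.

(** The hypotheses describe the extension by zero of a continuous function on
    [J01]: above a threshold [x] it has an open set of arguments in [J01],
    together with all the arguments outside when [x < 0]. *)
Lemma measurable_extension_by_0 (R : realType) (L := measurableTypeR R)
  (f : R * (R * R * R) * (R * R * R) -> R) :
  (forall p, J01 R p -> {for p, continuous f}) -> (forall p, ~ J01 R p -> f p = 0) ->
  measurable_fun setT (f : (L * (L * L * L) * (L * L * L))%type -> R).
Proof.
move=> cf f0.
apply: (measurability (@RGenOInfty.G R)); first exact: RGenOInfty.measurableE.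
move=> _ [_ [x ->] <-]; rewrite setTI.
have mJ := open_measurable_R7 (@J01_open R).
have oO : open (J01 R `&` f @^-1` `]x, +oo[).
  rewrite openE => p [Jp fp].
  apply: filterI; first exact: open_nbhs_nbhs (conj (@J01_open R) Jp).
  by apply: cf => //; apply: open_nbhs_nbhs; split => //; exact: itv_open.
rewrite (_ : f @^-1` _ = (J01 R `&` f @^-1` `]x, +oo[) `|`
    (if x < 0 then ~` J01 R else set0)).
  apply: measurableU; first exact: open_measurable_R7.
  by case: ifP => // _; exact: measurableC.
apply/seteqP; split=> p /=.
  move=> fp; have [Jp|Jp] := pselect (J01 R p); first by left.
  by right; move: fp; rewrite (f0 p Jp) in_itv /= andbT => ->.
case=> [[]//|]; case: ifP => // x0 Jp.
by rewrite (f0 p Jp) in_itv /= x0.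
Qed.

End Measurability.

(** * Invariance of the scalar product *)

Section Invariance.
Local Open Scope classical_set_scope.
Variable R : realType.
Local Notation V := (R * (R * R * R) * (R * R * R))%type.
Local Notation dinv := Defs.dinv.

Definition pairing (Psi1 Psi2 : J01 R -> R[i]) : V -> R[i] :=
  'valL_ 0 (fun p : J01 R => (Psi1 p)^* * Psi2 p).

Lemma pairingE Psi1 Psi2 p :
  pairing Psi1 Psi2 p = ('valL_ 0 Psi1 p)^* * 'valL_ 0 Psi2 p.
Proof.
have [pJ|pJ] := pselect (J01 R p); last by rewrite [LHS]valL0_out // !valL0_out // mulr0.
have [q ->] := J01_val pJ.
by rewrite [LHS]valL0_val !valL0_val.
Qed.

Lemma pairing_out Psi1 Psi2 p : ~ J01 R p -> pairing Psi1 Psi2 p = 0.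
Proof. exact: valL0_out. Qed.

Lemma Rintegral_J01 (f : V -> R) :
  (forall p, ~ J01 R p -> f p = 0) ->
  \int[@lebesgue_RR3R3 R]_(p in J01 R) f p = \int[@lebesgue_RR3R3 R]_p f p.
Proof.
move=> f0; rewrite /Rintegral [in LHS]integral_mkcond.
congr fine; apply: eq_integral => p _; rewrite patchE; case: ifPn => // /negP pJ.
by rewrite f0 // => Jp; apply: pJ; exact: mem_set.
Qed.

Lemma scalar_productE (Psi1 Psi2 : J01 R -> R[i]) :
  scalar_product Psi1 Psi2 =
  Complex (\int[@lebesgue_RR3R3 R]_p complex.Re (pairing Psi1 Psi2 p))
          (\int[@lebesgue_RR3R3 R]_p complex.Im (pairing Psi1 Psi2 p)).
Proof.
rewrite -!Rintegral_J01 // => p pJ; first by rewrite pairing_out.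
by rewrite pairing_out.
Qed.

Lemma pairing_Xi phi Psi1 Psi2 p :
  pairing (Xi phi Psi1) (Xi phi Psi2) p =
  (((dfun phi)^`()%classic (dinv phi p.1.1) ^+ 2)%:C)%C *
     pairing Psi1 Psi2 (prolong_ext phi^-1%g p).
Proof.
rewrite !pairingE !valL_Xi rmorphM mulrACA rmorphXn /= expr2; congr (_ * _ * _).
exact: conjc_real.
Qed.

Lemma continuous_pairing_parts (Psi1 Psi2 : smoothJ R) :
  (forall p, J01 R p -> {for p, continuous (@complex.Re R \o pairing Psi1 Psi2)}) /\
  (forall p, J01 R p -> {for p, continuous (@complex.Im R \o pairing Psi1 Psi2)}).
Proof.
have Jo := @J01_open R.
have /asboolP[/(_ 0) r1 /(_ 0) i1] := valP Psi1.
have /asboolP[/(_ 0) r2 /(_ 0) i2] := valP Psi2.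
split.
  apply: (Ck_eq Jo _ (CkD Jo (CkM Jo r1 r2) (CkM Jo i1 i2))) => p _.
  rewrite [RHS]/= pairingE.
  rewrite -[LHS]/(complex.Re ('valL_ 0 Psi1 p) * complex.Re ('valL_ 0 Psi2 p) +
    complex.Im ('valL_ 0 Psi1 p) * complex.Im ('valL_ 0 Psi2 p)).
  case: ('valL_ 0 Psi1 p) ('valL_ 0 Psi2 p) => a b [c d] /=.
  by rewrite mulNr opprK.
apply: (Ck_eq Jo _ (CkD Jo (CkM Jo r1 i2) (CkZ (-1) Jo (CkM Jo i1 r2)))) => p _.
rewrite [RHS]/= pairingE.
rewrite -[LHS]/(complex.Re ('valL_ 0 Psi1 p) * complex.Im ('valL_ 0 Psi2 p) +
  -1 * (complex.Im ('valL_ 0 Psi1 p) * complex.Re ('valL_ 0 Psi2 p))).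
case: ('valL_ 0 Psi1 p) ('valL_ 0 Psi2 p) => a b [c d] /=.
by rewrite mulN1r mulNr.
Qed.

Lemma scalar_product_Xi phi (Psi1 Psi2 : smoothJ R) :
  scalar_product (Xi phi Psi1) (Xi phi Psi2) = scalar_product Psi1 Psi2.
Proof.
have [cRe cIm] := continuous_pairing_parts Psi1 Psi2.
rewrite !scalar_productE; congr Complex.
  rewrite -(Rintegral_prolong phi (measurable_extension_by_0 cRe _)).
    apply: eq_Rintegral => p _; rewrite pairing_Xi /=.
    by case: (pairing _ _ _) => a b /=; rewrite mul0r subr0.
  by move=> p pJ /=; rewrite pairing_out.
rewrite -(Rintegral_prolong phi (measurable_extension_by_0 cIm _)).
  apply: eq_Rintegral => p _; rewrite pairing_Xi /=.
  by case: (pairing _ _ _) => a b /=; rewrite mul0r addr0.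
by move=> p pJ /=; rewrite pairing_out.
Qed.

End Invariance.

Theorem theorem5p2 (R : realType) :
  exists rho : diffeo R -> smoothJ R -> smoothJ R,
    [/\ forall (phi : diffeo R) (Psi : smoothJ R),
          smoothJ_fun (rho phi Psi) = Xi phi (smoothJ_fun Psi),
        @linear_representation (diffeo R) R[i] (smoothJ R) rho,
        forall (phi : diffeo R) (Psi : smoothJ R),
          compactly_supported Psi -> compactly_supported (rho phi Psi) &
        forall (phi : diffeo R) (Psi1 Psi2 : smoothJ R),
          compactly_supported Psi1 -> compactly_supported Psi2 ->
          scalar_product (rho phi Psi1) (rho phi Psi2) =
          scalar_product Psi1 Psi2].
Proof.
exists (@XiJ R); split => //.
- exact: XiJ_representation.
- by move=> phi Psi; exact: compactly_supported_Xi.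
- by move=> phi Psi1 Psi2 _ _; exact: scalar_product_Xi.
Qed.
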